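(* Let $f\in H^{-1}(\Omega)$ and let $u\in\mathcal V_0$ be a solution of $$(\kappa(x,u)u',v')=(f,v)\quad\text{for all } v\in\mathcal V_0 .$$ If $$\max_{0\le k\le n-1}|u(a_k)-u(a_{k+1})|<\frac{2k_\alpha}{L_0},$$ then $u$ is the unique solution in $\mathcal V_0$ of this discrete problem.
   Context: $\Omega=(a,b)\subset\mathbb R$ is a bounded open interval with a subdivision $a=a_0<a_1<\dots<a_{n-1}<a_n=b$, not assumed uniform. $\mathcal V_0\subset H^1_0(\Omega)$ is the space of continuous functions on $[a,b]$ that are affine on each interval $(a_{k-1},a_k)$, $k=1,\dots,n$, and satisfy $v(a)=v(b)=0$. Here $(u,v)=\int_\Omega uv$ (understood as the duality pairing when one argument is in $H^{-1}(\Omega)$), and $v'=\mathrm dv/\mathrm dx$. The coefficient $\kappa:\Omega\times\mathbb R\to\mathbb R$ is a Carathéodory function (measurable in $x$ for each $s$, continuous in $s$ for a.e. $x$). There are constants $0<k_\alpha<k_\beta$ with $k_\alpha<\kappa(x,s)<k_\beta$ for all $s\in\mathbb R$ and a.e. $x\in\Omega$, and a constant $L_0>0$ with $|\kappa(x,s)-\kappa(x,t)|\le L_0|s-t|$ for all $s,t\in\mathbb R$ and a.e. $x\in\Omega$. The discrete equation is the finite element weak form of $-(\kappa(x,u)u')'=f$ in $\Omega$ with homogeneous Dirichlet boundary conditions. *)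

(* Defs.v *)
From HB Require Import structures.
From mathcomp Require Import all_boot all_order all_algebra.
From mathcomp Require Import all_classical all_reals all_analysis.

Set Implicit Arguments.
Unset Strict Implicit.
Unset Printing Implicit Defensive.

Import Order.TTheory GRing.Theory Num.Theory.
Import numFieldNormedType.Exports.

Local Open Scope classical_set_scope.
Local Open Scope ring_scope.

(* The real line with the Lebesgue (completed) sigma-algebra: the library's
   [measurableTypeR R] only carries the Borel one. *)
Definition lebR (R : realType) := caratheodory_type (@wlength R idfun)^*%mu.

Definition leb (R : realType) : {measure set (lebR R) -> \bar R} :=
  @completed_lebesgue_measure R.

Section Sobolev.
Variables (R : realType) (a b : R).

(* Functions on the interval are represented by functions on R whose values
   outside the interval are irrelevant. *)
Definition Omega : set (lebR R) := [set` `]a, b[ ].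

(* (g, h) *)
Definition pairing (g h : R -> R) : R := \int[leb R]_(x in Omega) (g x * h x).

Definition L2 (g : R -> R) : Prop :=
  measurable_fun Omega (g : lebR R -> R) /\
  (leb R).-integrable Omega (fun x => (g x ^+ 2)%:E).

(* C_c^oo(a, b) *)
Definition test_function (phi : R -> R) : Prop :=
  (forall (j : nat) (x : R), derivable (derive1n j phi) x 1) /\
  exists c d : R, [/\ a < c, d < b & forall x, x \notin `[c, d] -> phi x = 0].

Definition weak_derivative (v dv : R -> R) : Prop :=
  forall phi, test_function phi -> pairing v (derive1 phi) = - pairing dv phi.

(* v is in H^1(a, b), with weak derivative dv *)
Definition H1 (v dv : R -> R) : Prop :=
  [/\ L2 v, L2 dv & weak_derivative v dv].

Definition H1norm (v dv : R -> R) : R :=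
  Num.sqrt (pairing v v + pairing dv dv).

(* H^1_0(a, b): the closure of C_c^oo(a, b) in H^1(a, b) *)
Definition H10 (v : R -> R) : Prop :=
  exists dv, H1 v dv /\
  exists phi : nat -> R -> R, (forall m, test_function (phi m)) /\
    (fun m => H1norm (v \- phi m) (dv \- derive1 (phi m))) @ \oo --> (0 : R).

(* H^-1(a, b): bounded linear functionals on H^1_0(a, b); boundedness makes
   [F v] depend only on the a.e. class of v on the interval, and [F v] is the
   duality pairing (F, v). *)
Definition Hminus1 (F : (R -> R) -> R) : Prop :=
  (forall (c : R) (v w : R -> R), H10 v -> H10 w ->
     F (fun x => c * v x + w x) = c * F v + F w) /\
  exists C : R, forall v dv : R -> R, H10 v -> H1 v dv ->
    `|F v| <= C * H1norm v dv.

Definition subdivision (n : nat) (t : nat -> R) : Prop :=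
  [/\ t 0%N = a, t n = b & forall k, (k < n)%N -> t k < t k.+1].

Definition V0 (n : nat) (t : nat -> R) (v : R -> R) : Prop :=
  [/\ {within `[a, b], continuous v},
      forall k, (k < n)%N ->
        exists p q : R, forall x, x \in `]t k, t k.+1[ -> v x = p * x + q,
      v a = 0 & v b = 0].

Definition caratheodory_function (kappa : R -> R -> R) : Prop :=
  (forall s, measurable_fun Omega ((fun x => kappa x s) : lebR R -> R)) /\
  (\forall x \ae leb R, Omega x -> continuous (kappa x)).

(* On V0 the derivatives are classical off the finitely many nodes, where the
   value of [derive1] is irrelevant to the integral. *)
Definition discrete_solution (kappa : R -> R -> R) (F : (R -> R) -> R)
    (n : nat) (t : nat -> R) (u : R -> R) : Prop :=
  V0 n t u /\
  forall v, V0 n t v ->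
    pairing (fun x => kappa x (u x) * derive1 u x) (derive1 v) = F v.

End Sobolev.

(* Main.v *)
(* Differences are tested against hat functions: if u and w are discrete
   solutions, then J_i = int_(I_i) (kappa(x,u) u' - kappa(x,w) w') is
   proportional to the length h_i of the element I_i, so all J_i have the same
   sign.  Write e = u - w, and suppose that e has opposite signs (or vanishes) at
   the two ends of I_i.  Then |e| integrates over I_i to at most h_i |D| / 2 with
   D the increment of e, and
     J_i D >= D^2 (k_alpha - L_0 |u(t_i) - u(t_(i+1))| / 2),
   so J_i D > 0 unless D = 0.  Hence, if all J_i >= 0, e can never pass from >= 0
   to <= 0 except by vanishing at both nodes; as e vanishes at both ends of the
   interval, e >= 0 at all nodes (going forward) and e <= 0 (going backward).
   The case J_i <= 0 follows by changing the sign of e. *)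
Require Import Defs.
From HB Require Import structures.
From mathcomp Require Import all_boot all_order all_algebra.
From mathcomp Require Import all_classical all_reals all_analysis.
From mathcomp Require Import measurable_realfun lra ring zify.

Set Implicit Arguments.
Unset Strict Implicit.
Unset Printing Implicit Defensive.

Import Order.TTheory GRing.Theory Num.Theory.
Import numFieldNormedType.Exports.

Local Open Scope classical_set_scope.
Local Open Scope ring_scope.

(** * Integration with respect to completed Lebesgue measure *)

Section CompletedLebesgue.
Variable R : realType.

Lemma measurable_leb (A : set R) :
  measurable (A : set (measurableTypeR R)) -> measurable (A : set (lebR R)).
Proof. exact: sub_caratheodory. Qed.

Lemma measurable_fun_leb (D : set R) (g : R -> R) :
  measurable (D : set (measurableTypeR R)) ->
  measurable_fun (D : set (measurableTypeR R)) g ->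
  measurable_fun (D : set (lebR R)) (g : lebR R -> R).
Proof. by move=> mD mg _ Y mY; apply: measurable_leb; exact: mg. Qed.

Lemma measurable_leb_itv (i : interval R) : measurable ([set` i] : set (lebR R)).
Proof. by apply: measurable_leb; exact: measurable_itv. Qed.

Lemma leb_itv (i : interval R) : leb R [set` i] = lebesgue_measure [set` i].
Proof. by []. Qed.

Lemma leb_itvoo (s r : R) : s <= r -> leb R `]s, r[%classic = (r - s)%:E.
Proof.
move=> sr; rewrite leb_itv lebesgue_measure_itv/= lte_fin.
by case: ltP => // rs; rewrite (le_anti (introT andP (conj sr rs))) subrr.
Qed.

Lemma leb_set1 (x : R) : leb R [set x] = 0%E.
Proof. exact: (lebesgue_measure_set1 x). Qed.

(** Completeness of the measure: changing a function on a null set keeps it measurable. *)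
Lemma ae_measurable_leb (D : set (lebR R)) (g h : lebR R -> R) :
  measurable_fun D g -> {ae leb R, forall x, D x -> g x = h x} ->
  measurable_fun D h.
Proof.
move=> mg gh; apply/measurable_EFinP.
apply: (@ae_measurable_fun _ _ _ (leb R) _ D (EFin \o g) (EFin \o h)).
- exact: completed_lebesgue_measure_is_complete.
- by apply: filterS gh => x /[apply]/= ->.
- exact/measurable_EFinP.
Qed.

Lemma ae_eq_Rintegral_leb (D : set (lebR R)) (g h : lebR R -> R) :
  measurable D -> measurable_fun D g ->
  {ae leb R, forall x, D x -> g x = h x} ->
  \int[leb R]_(x in D) h x = \int[leb R]_(x in D) g x.
Proof.
move=> mD mg gh; congr fine; apply/esym/ae_eq_integral.
- exact: mD.
- exact/measurable_EFinP.
- apply/measurable_EFinP; exact: ae_measurable_leb gh.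
- by apply: filterS gh => x /[apply]/= ->.
Qed.

Lemma integrable_leb_bounded (s r M : R) (g : lebR R -> R) :
  measurable_fun (`]s, r[%classic : set (lebR R)) g ->
  (forall x, x \in `]s, r[ -> `|g x| <= M) ->
  (leb R).-integrable `]s, r[ (EFin \o g).
Proof.
move=> mg gM; apply: measurable_bounded_integrable => //.
- exact: measurable_leb_itv.
- rewrite leb_itv lebesgue_measure_itv/=.
  by case: ifP => // _; rewrite -EFinB ltry.
- exists M; split; rewrite ?num_real// => N MN x /= xI.
  by rewrite (le_trans (gM _ xI))// ltW.
Qed.

(** The identity, from the completed to the Borel sigma-algebra, is measurable and pushes [leb]
    forward to [lebesgue_measure]. This gives access to the fundamental theorem of calculus. *)
Lemma integral_leb_lebesgue (i : interval R) (g : R -> R) :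
  measurable_fun [set: R] g ->
  (leb R).-integrable [set` i] (EFin \o g) ->
  \int[leb R]_(x in [set` i]) g x = \int[lebesgue_measure]_(x in [set` i]) g x.
Proof.
move=> mg ig.
have mid : measurable_fun [set: lebR R] (idfun : lebR R -> measurableTypeR R).
  by move=> _ Y mY; rewrite setTI; exact: measurable_leb.
have mg' : measurable_fun [set: measurableTypeR R] (EFin \o g).
  exact/measurable_EFinP.
congr fine.
rewrite -[LHS](@integral_pushforward _ _ (lebR R) (measurableTypeR R) R idfun
  mid (leb R) [set` i] (EFin \o g) mg' ig (measurable_itv i)).
exact: eq_measure_integral.
Qed.

Lemma integral_leb_id (s r : R) : s < r ->
  \int[leb R]_(x in `]s, r[) (x - s) = (r - s) ^+ 2 / 2.
Proof.
move=> sr.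
have cf : continuous (fun x : R => x - s).
  by move=> x; apply: cvgB; [exact: cvg_id|exact: cvg_cst].
have mf : measurable_fun [set: R] (fun x : R => x - s) by exact: continuous_measurable_fun.
rewrite integral_leb_lebesgue; [|exact: mf|]; last first.
  apply: (@integrable_leb_bounded _ _ (r - s)).
    apply: measurable_fun_leb; first exact: measurable_itv.
    exact: measurable_funTS.
  move=> x; rewrite in_itv/= => /andP[sx xr]; rewrite ger0_norm; last by rewrite subr_ge0 ltW.
  by rewrite lerD2r ltW.
pose F (x : R) := (x - s) ^+ 2 / 2.
have dF (x : R) : is_derive x 1 F (x - s).
  rewrite /F; apply: is_derive_eq.
  by rewrite /= /GRing.scale/=; field.
have cF : continuous F.
  by move=> x; apply/differentiable_continuous/derivable1_diffP; exact: ex_derive.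
have mfE A : measurable_fun A (fun x : R => (x - s)%:E).
  by apply/measurable_EFinP; exact: measurable_funTS.
(* The endpoints are added to the open interval, one at a time, to reach the closed interval of the
   fundamental theorem. *)
rewrite /Rintegral integral_itv_bndo_bndc; last exact: mfE.
rewrite integral_itv_obnd_cbnd; last exact: mfE.
rewrite (@continuous_FTC2 _ (fun x => x - s) F)//.
- by rewrite /F /= subrr expr0n/= mul0r subr0.
- exact: continuous_subspaceT.
- split=> [x _||].
  + exact: ex_derive.
  + by apply: cvg_at_right_filter; apply: cF.
  + by apply: cvg_at_left_filter; apply: cF.
- by move=> x _; rewrite derive1E; apply: derive_val.
Qed.

End CompletedLebesgue.

(** * Replacing the coefficient by one that is regular at every point *)

Section RegularCoefficient.
Variable R : realType.

(** The set where g < 0 is open, so if it were nonempty it would contain a rational. *)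
Lemma continuous_ge0_rat (g : R -> R) : continuous g ->
  (forall q : rat, 0 <= g (ratr q)) -> forall s, 0 <= g s.
Proof.
move=> cg g0 s; rewrite leNgt; apply/negP => gs.
have oU : open [set y | g y < 0].
  by apply: (open_comp (f := g) (D := [set y | y < 0])) => //; exact: open_lt.
have [x [/= gx [q _ qx]]] : [set y | g y < 0] `&` @ratr R @` setT !=set0.
  by apply: dense_rat => //; exists s.
by move: gx; rewrite -qx ltNge g0.
Qed.

Lemma lipschitz_rat (L : R) (g : R -> R) : continuous g ->
  (forall p q : rat, `|g (ratr p) - g (ratr q)| <= L * `|ratr p - ratr q|) ->
  forall s r, `|g s - g r| <= L * `|s - r|.
Proof.
move=> cg gL s r.
have cgr z : continuous (fun y => L * `|y - z| - `|g y - g z|).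
  move=> y; apply: cvgB.
    apply: cvgM; first exact: cvg_cst.
    by apply: cvg_norm; apply: cvgB; [exact: cvg_id|exact: cvg_cst].
  by apply: cvg_norm; apply: cvgB; [exact: cg|exact: cvg_cst].
(* One variable at a time: s is reduced to a rational with r fixed, then r is reduced with that
   rational fixed. *)
rewrite -subr_ge0; apply: (continuous_ge0_rat (cgr r)) => p.
rewrite subr_ge0 distrC (distrC (ratr p)) -subr_ge0.
apply: (continuous_ge0_rat (cgr (ratr p))) => q.
by rewrite subr_ge0.
Qed.

(** The exceptional null sets of the hypotheses depend on s and r. Over rational values their union
    is still null, and continuity in s extends the estimates to all reals, the strict bounds
    becoming weak ones. At the remaining bad points the coefficient is replaced by the constant
    [ka]. *)
Lemma regular_coefficient (a b ka kb L0 : R) (kappa : R -> R -> R) :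
  caratheodory_function a b kappa -> ka < kb -> 0 < L0 ->
  (forall s : R, \forall x \ae leb R, Omega a b x -> ka < kappa x s < kb) ->
  (forall s r : R, \forall x \ae leb R,
    Omega a b x -> `|kappa x s - kappa x r| <= L0 * `|s - r|) ->
  exists k : R -> R -> R,
    [/\ forall s, measurable_fun (Omega a b) ((fun x => k x s) : lebR R -> R),
        forall x s, ka <= k x s <= kb,
        forall x s r, `|k x s - k x r| <= L0 * `|s - r| &
        {ae leb R, forall x, Omega a b x -> forall s, kappa x s = k x s}].
Proof.
move=> [mk ck] kab L00 hb hl.
pose good x := [/\ forall s, ka <= kappa x s <= kb &
  forall s r, `|kappa x s - kappa x r| <= L0 * `|s - r|].
(* Rationals are coded by natural numbers to use countable intersections; numbers that code no
   rational are sent to 0. *)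
have enumq (P : rat -> lebR R -> Prop) :
    (forall q, \forall x \ae leb R, P q x) -> \forall x \ae leb R, forall q, P q x.
  move=> /(fun h n => h (odflt 0 (@unpickle rat n)))/ae_foralln.
  by apply: filterS => x Px q; have := Px (pickle q); rewrite pickleK.
have gae : \forall x \ae leb R, Omega a b x -> good x.
  have h1 := enumq _ (fun q => hb (ratr q)).
  have h2 := enumq _ (fun p => enumq _ (fun q => hl (ratr p) (ratr q))).
  apply: filterS3 ck h1 h2 => x cx bx lx xO; split => [s|].
    have cB c : continuous (fun y => kappa x y - c).
      by move=> y; apply: cvgB; [exact: cx|exact: cvg_cst].
    have cB' c : continuous (fun y => c - kappa x y).
      by move=> y; apply: cvgB; [exact: cvg_cst|exact: cx].
    apply/andP; split; rewrite -subr_ge0.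
      apply: (continuous_ge0_rat (cB ka)) => q.
      by have /andP[? _] := bx q xO; rewrite subr_ge0 ltW.
    apply: (continuous_ge0_rat (cB' kb)) => q.
    by have /andP[_ ?] := bx q xO; rewrite subr_ge0 ltW.
  by apply: lipschitz_rat; [exact: cx|move=> p q; exact: lx].
have kae : {ae leb R, forall x, Omega a b x -> forall s,
    kappa x s = if `[< good x >] then kappa x s else ka}.
  by apply: filterS gae => x gx xO s; rewrite asboolT//; exact: gx.
exists (fun x s => if `[< good x >] then kappa x s else ka); split; last exact: kae.
- move=> s; apply: ae_measurable_leb (mk s) _.
  by apply: filterS kae => x h xO; exact: h.
- by move=> x s; case: asboolP => [[]//|_]; rewrite lexx ltW.
- move=> x s r; case: asboolP => [[]//|_].
  by rewrite subrr normr0 mulr_ge0// ltW.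
Qed.

(* A Lipschitz function is the infimal convolution of its values at the
   rationals with the cone L|.|, which makes measurability a countable matter. *)
Lemma measurable_comp_lipschitz (D : set (lebR R)) (L c : R)
    (k : R -> R -> R) (v : R -> R) : 0 < L ->
  (forall s, measurable_fun D ((fun x => k x s) : lebR R -> R)) ->
  (forall x s, c <= k x s) ->
  (forall x s r, `|k x s - k x r| <= L * `|s - r|) ->
  measurable_fun D (v : lebR R -> R) ->
  measurable_fun D ((fun x => k x (v x)) : lebR R -> R).
Proof.
move=> L0 mk kc kL mv.
(* Enumerating the rationals, with 0 where n codes none, makes the infimum one over a sequence. *)
pose q n : R := ratr (odflt 0 (@unpickle rat n)).
pose h n (x : lebR R) : R := k x (q n) + L * `|v x - q n|.
(* The Lipschitz bound puts every cone above the graph of k(x, .). *)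
have hlb x : lbound (range (h ^~ x)) (k x (v x)).
  move=> _ [n _ <-]; rewrite /h -lerBlDl.
  by apply: le_trans (kL x (v x) (q n)); exact: ler_norm.
rewrite (_ : (fun x => _) = (fun x => infs (h ^~ x) 0%N)).
  apply: measurable_fun_infs => [x _|n].
    by exists (k x (v x)); exact: hlb.
  apply: measurable_funD; first exact: mk.
  apply: measurable_funM; first exact: measurable_cst.
  apply: (measurableT_comp (@normr_measurable R setT)).
  by apply: measurable_funB; [exact: mv|exact: measurable_cst].
apply/funext => x; rewrite /infs/=; apply/le_anti/andP; split.
  apply: lb_le_inf => [|_ [n _ <-]]; first by exists (h 0%N x); exists 0%N.
  by apply: hlb; exists n.
apply/ler_addgt0Pr => e e0.
(* At distance below e / (2L), the cone term and the variation of k each cost at most e / 2. *)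
have [p] : exists p : rat, ratr p \in `]v x, v x + e / (2 * L)[.
  by apply: rat_in_itvoo; rewrite ltrDl divr_gt0// mulr_gt0.
rewrite in_itv/= => /andP[vp pv].
suff : inf (sdrop (h ^~ x) 0) <= k x (v x) + e by [].
apply: (@le_trans _ _ (h (pickle p) x)).
  apply: ge_inf; last by exists (pickle p).
  by exists (k x (v x)) => _ [n _ <-]; apply: hlb; exists n.
rewrite /h /q pickleK/=; set r := ratr p in vp pv *.
have kr : k x r - k x (v x) <= L * `|r - v x| by rewrite (le_trans (ler_norm _)).
rewrite (distrC (v x)) ger0_norm in kr *; last by rewrite subr_ge0 ltW.
have : L * (r - v x) <= L * (e / (2 * L)) by rewrite ler_pM2l// lerBlDl ltW.
rewrite (_ : L * (e / (2 * L)) = e / 2); last by field; rewrite gt_eqF.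
move: (k x r) (k x (v x)) kr => A B AB h2.
move: (L * _) AB h2 => C; lra.
Qed.

End RegularCoefficient.

(** * Subdivisions and piecewise affine functions *)

Section PiecewiseAffine.
Variable R : realType.
Implicit Types (a b : R) (t : nat -> R) (v : R -> R).

Definition slope t v (k : nat) : R := (v (t k.+1) - v (t k)) / (t k.+1 - t k).

Lemma subdivision_le a b n t k l : subdivision a b n t ->
  (k <= l)%N -> (l <= n)%N -> t k <= t l.
Proof.
move=> [_ _ tS]; elim: l => [|l IH]; first by rewrite leqn0 => /eqP ->.
rewrite leq_eqVlt => /predU1P[->//|kl] ln.
by rewrite (le_trans (IH kl (ltnW ln)))// ltW// tS.
Qed.

Lemma subdivision_lt a b n t k : subdivision a b n t ->
  (k < n)%N -> t k < t k.+1.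
Proof. by move=> [_ _]; apply. Qed.

Lemma subdivision_ge a b n t k : subdivision a b n t -> (k <= n)%N -> a <= t k.
Proof. by move=> st kn; have [<- _ _] := st; exact: subdivision_le st _ kn. Qed.

Lemma subdivision_le_b a b n t k : subdivision a b n t -> (k <= n)%N -> t k <= b.
Proof. by move=> st kn; have [_ <- _] := st; exact: subdivision_le st kn _. Qed.

Lemma subdivision_cover a b n t x : subdivision a b n t ->
  x \in `[a, b] -> x = a \/ exists2 k, (k < n)%N & x \in `[t k, t k.+1].
Proof.
move=> [t0 <- _]; rewrite in_itv/= -t0 => /andP[ax].
(* Induction on the number of elements; with none left, x is squeezed to t_0 = a. *)
elim: n => [|n IH] xn; first by left; apply/le_anti; rewrite ax xn.
have [/IH[->|[k kn xk]]|nx] := leP x (t n); first by left.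
  by right; exists k => //; exact: ltnW.
by right; exists n; rewrite ?in_itv//= ltW.
Qed.

(** Both sides have one-sided limits at the endpoints, and these agree by uniqueness of limits. *)
Lemma affine_closed_itv (s r p q : R) v : s < r ->
  {within `[s, r], continuous v} ->
  (forall x, x \in `]s, r[ -> v x = p * x + q) ->
  forall x, x \in `[s, r] -> v x = p * x + q.
Proof.
move=> sr /(continuous_within_itvP _ sr)[_ vs vr] vpq x.
have pqc : continuous (fun y : R => p * y + q).
  by move=> y; apply: cvgD; [apply: cvgM; [exact: cvg_cst|exact: cvg_id]|exact: cvg_cst].
have Hs : v s = p * s + q.
  apply: (cvg_unique (@Rhausdorff R) vs).
  have : (p * y + q) @[y --> s^'+] --> p * s + q.
    by apply: cvg_at_right_filter; exact: pqc.
  apply: cvg_trans; apply: near_eq_cvg; near=> y; apply/esym/vpq.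
  by rewrite in_itv/=; apply/andP; split; near: y; [exact: nbhs_right_gt|exact: nbhs_right_lt].
have Hr : v r = p * r + q.
  apply: (cvg_unique (@Rhausdorff R) vr).
  have : (p * y + q) @[y --> r^'-] --> p * r + q.
    by apply: cvg_at_left_filter; exact: pqc.
  apply: cvg_trans; apply: near_eq_cvg; near=> y; apply/esym/vpq.
  by rewrite in_itv/=; apply/andP; split; near: y; [exact: nbhs_left_gt|exact: nbhs_left_lt].
rewrite in_itv/= => /andP[].
rewrite le_eqVlt => /predU1P[<-//|sx]; rewrite le_eqVlt => /predU1P[->//|xr].
by apply: vpq; rewrite in_itv/= sx.
Unshelve. all: by end_near.
Qed.

Lemma V0_affine a b n t v k : subdivision a b n t -> V0 a b n t v -> (k < n)%N ->
  forall x, x \in `[t k, t k.+1] -> v x = v (t k) + slope t v k * (x - t k).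
Proof.
move=> st [cv /(_ _) vaff _ _] kn.
have lt := subdivision_lt st kn.
have [p [q vpq]] := vaff k kn.
have ck : {within `[t k, t k.+1], continuous v}.
  apply: continuous_subspaceW cv => x /=; rewrite !in_itv/= => /andP[h1 h2].
  rewrite (le_trans (subdivision_ge st (ltnW kn)))//=.
  by rewrite (le_trans h2)// (subdivision_le_b st).
have H := affine_closed_itv lt ck vpq.
move=> x xk; rewrite /slope (H _ xk) (H (t k)) ?(H (t k.+1)) ?in_itv/= ?lexx ?ltW//.
by field; rewrite subr_eq0 gt_eqF.
Qed.

(** Near an interior point of an element, v coincides with its affine formula. *)
Lemma V0_derive1 a b n t v k : subdivision a b n t -> V0 a b n t v -> (k < n)%N ->
  forall x, x \in `]t k, t k.+1[ -> derive1 v x = slope t v k.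
Proof.
move=> st Vv kn x xk.
rewrite derive1E (@near_eq_derive _ _ _ _ (fun y => v (t k) + slope t v k * (y - t k))).
  have : is_derive x 1 (fun y => v (t k) + slope t v k * (y - t k)) (slope t v k).
    apply: is_derive_eq; rewrite /GRing.scale/=; ring.
  by move=> ?; exact: derive_val.
near=> y; apply: (V0_affine st Vv kn); apply: subset_itv_oo_cc.
by near: y; exact: near_in_itvoo.
Unshelve. all: by end_near.
Qed.

End PiecewiseAffine.

(** * Hat functions and their derivatives *)

Section HatFunctions.
Variable R : realType.
Implicit Types (a b : R) (t : nat -> R) (v : R -> R).

(** The nodal basis function of the interior node t_(k+1), indexed by the left end of its support
    [t_k, t_(k+2)]. The max-min form makes continuity immediate. *)
Definition hat t (k : nat) (x : R) : R :=
  Num.max 0 (Num.min ((x - t k) / (t k.+1 - t k))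
                     ((t k.+2 - x) / (t k.+2 - t k.+1))).

(** Up to the peak, the rising ratio is at most 1 and the falling one at least 1. *)
Lemma hat_left t k x : t k.+1 < t k.+2 -> t k < t k.+1 -> x <= t k.+1 ->
  hat t k x = Num.max 0 ((x - t k) / (t k.+1 - t k)).
Proof.
move=> t2 t1 xt; rewrite /hat min_l//.
apply: (@le_trans _ _ 1); first by rewrite ler_pdivrMr ?subr_gt0// mul1r lerD2r.
by rewrite ler_pdivlMr ?subr_gt0// mul1r lerD2l lerN2.
Qed.

Lemma hat_right t k x : t k.+1 < t k.+2 -> t k < t k.+1 -> t k.+1 <= x ->
  hat t k x = Num.max 0 ((t k.+2 - x) / (t k.+2 - t k.+1)).
Proof.
move=> t2 t1 xt; rewrite /hat min_r//.
apply: (@le_trans _ _ 1); last by rewrite ler_pdivlMr ?subr_gt0// mul1r lerD2r.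
by rewrite ler_pdivrMr ?subr_gt0// mul1r lerD2l lerN2.
Qed.

Lemma hat_left0 t k x : t k.+1 < t k.+2 -> t k < t k.+1 -> x <= t k ->
  hat t k x = 0.
Proof.
move=> t2 t1 xt; rewrite hat_left// ?(le_trans xt (ltW t1))// max_l//.
by rewrite pmulr_lle0 ?invr_gt0 ?subr_gt0// subr_le0.
Qed.

Lemma hat_right0 t k x : t k.+1 < t k.+2 -> t k < t k.+1 -> t k.+2 <= x ->
  hat t k x = 0.
Proof.
move=> t2 t1 xt; rewrite hat_right// ?(le_trans (ltW t2) xt)// max_l//.
by rewrite pmulr_lle0 ?invr_gt0 ?subr_gt0// subr_le0.
Qed.

Lemma continuous_hat t k : continuous (hat t k).
Proof.
move=> x.
pose l (y : R) : R^o := (y - t k) / (t k.+1 - t k).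
pose r (y : R) : R^o := (t k.+2 - y) / (t k.+2 - t k.+1).
have cl : {for x, continuous l}.
  apply: cvgM; last exact: cvg_cst.
  by apply: cvgB; [exact: cvg_id|exact: cvg_cst].
have cr : {for x, continuous r}.
  apply: cvgM; last exact: cvg_cst.
  by apply: cvgB; [exact: cvg_cst|exact: cvg_id].
exact: (continuous_max (f := cst 0) (cvg_cst _) (continuous_min cl cr)).
Qed.

Lemma V0_hat a b n t k : subdivision a b n t -> (k.+1 < n)%N ->
  V0 a b n t (hat t k).
Proof.
move=> st kn; have kn' := ltnW kn.
have t1 := subdivision_lt st kn'; have t2 := subdivision_lt st kn.
split.
- exact/continuous_subspaceT/continuous_hat.
(* Elements left of the support; then its second element and those to its right; finally its first
   element. *)
- move=> l ln; have [lk|kl|lk] := ltngtP l k.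
  + exists 0, 0 => x; rewrite in_itv/= => /andP[_ xl].
    rewrite hat_left0 ?mul0r ?addr0// (le_trans (ltW xl))//.
    exact: subdivision_le st lk (ltnW kn').
  + have [lk1|lk1] := eqVneq l k.+1.
      exists (- (t k.+2 - t k.+1)^-1), (t k.+2 / (t k.+2 - t k.+1)) => x.
      rewrite lk1 in_itv/= => /andP[lx xl]; rewrite hat_right ?(ltW lx)// max_r.
        by rewrite mulrBl addrC mulNr mulrC.
      by rewrite divr_ge0// subr_ge0 ltW.
    exists 0, 0 => x; rewrite in_itv/= => /andP[lx _].
    rewrite hat_right0 ?mul0r ?addr0// (le_trans _ (ltW lx))//.
    by apply: (subdivision_le st _ (ltnW ln)); rewrite ltn_neqAle eq_sym lk1.
  + exists (t k.+1 - t k)^-1, (- t k / (t k.+1 - t k)) => x.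
    rewrite lk in_itv/= => /andP[lx xl]; rewrite hat_left ?(ltW xl)// max_r.
      by rewrite mulrBl mulNr mulrC.
    by rewrite divr_ge0// subr_ge0 ltW.
- by rewrite hat_left0// (subdivision_ge st)// ltnW.
- by rewrite hat_right0// (subdivision_le_b st).
Qed.

Lemma derive1_eq0_near (g : R -> R) (x : R) :
  (\forall y \near x, g y = 0) -> derive1 g x = 0.
Proof.
move=> g0; rewrite derive1E (@near_eq_derive _ _ _ _ (cst 0))//.
exact: derive_val.
Qed.

(** Off its three kinks the hat function is locally affine or locally zero. Indicator coefficients
    give one formula for all cases, matching the restricted integrands of [pairing_hat]. *)
Lemma derive1_hat a b n t k x : subdivision a b n t -> (k.+1 < n)%N ->
  x != t k -> x != t k.+1 -> x != t k.+2 ->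
  derive1 (hat t k) x = (x \in `]t k, t k.+1[)%:R / (t k.+1 - t k)
     - (x \in `]t k.+1, t k.+2[)%:R / (t k.+2 - t k.+1).
Proof.
move=> st kn x0 x1 x2; have kn' := ltnW kn.
have t1 := subdivision_lt st kn'; have t2 := subdivision_lt st kn.
have Vh := V0_hat st kn.
have h1 : hat t k (t k.+1) = 1.
  by rewrite hat_left// divff ?max_r// gt_eqF// subr_gt0.
have [xk|kx] := ltP x (t k).
  rewrite !in_itv/= !ltNge (ltW xk) (le_trans (ltW xk) (ltW t1))/= !mul0r subr0.
  apply: derive1_eq0_near; near=> y; apply: hat_left0 => //; apply: ltW.
  by near: y; exact: lt_nbhsl.
have {}kx : t k < x by rewrite lt_neqAle eq_sym x0.
have [xk1|k1x] := ltP x (t k.+1).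
  rewrite (V0_derive1 st Vh kn') ?in_itv/= ?kx ?xk1//.
  by rewrite ltNge (ltW xk1)/= mul0r subr0 /slope h1 hat_left0// subr0.
have {}k1x : t k.+1 < x by rewrite lt_neqAle eq_sym x1.
rewrite !in_itv/= kx k1x ltNge (ltW k1x)/= mul0r sub0r.
have [xk2|k2x] := ltP x (t k.+2).
  rewrite (V0_derive1 st Vh kn) ?in_itv/= ?k1x ?xk2//.
  by rewrite /slope h1 hat_right0// sub0r mulNr.
have {}k2x : t k.+2 < x by rewrite lt_neqAle eq_sym x2.
rewrite mul0r oppr0.
apply: derive1_eq0_near; near=> y; apply: hat_right0 => //; apply: ltW.
by near: y; exact: lt_nbhsr.
Unshelve. all: by end_near.
Qed.

Lemma ae_neq_leb (c : R) : {ae leb R, forall x : lebR R, (x : R) != c}.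
Proof.
exists [set c]; split; first by rewrite -set_itv1; exact: measurable_leb_itv.
  exact: leb_set1.
by move=> x /negP; rewrite negbK => /eqP.
Qed.

(** * Coefficient integrals and flux differences on one element *)

Section Coefficient.
Variables (a b : R) (n : nat) (t : nat -> R).
Hypotheses (st : subdivision a b n t).
Variables (ka kb L : R) (k : R -> R -> R).
Hypotheses (ka0 : 0 < ka) (L0 : 0 < L).
Hypothesis mk : forall s, measurable_fun (Omega a b) ((fun x => k x s) : lebR R -> R).
Hypothesis kbnd : forall x s, ka <= k x s <= kb.
Hypothesis klip : forall x s r, `|k x s - k x r| <= L * `|s - r|.

Local Notation el i := (`]t i, t i.+1[%classic : set (lebR R)).

Lemma measurable_V0 v : V0 a b n t v -> measurable_fun (Omega a b) (v : lebR R -> R).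
Proof.
move=> [cv _ _ _]; apply: measurable_fun_leb; first exact: measurable_itv.
apply: subspace_continuous_measurable_fun; first exact: measurable_itv.
by apply: continuous_subspaceW cv => x /=; exact: subset_itv_oo_cc.
Qed.

Lemma measurable_coef v : V0 a b n t v ->
  measurable_fun (Omega a b) ((fun x => k x (v x)) : lebR R -> R).
Proof.
move=> /measurable_V0 mv; apply: (measurable_comp_lipschitz (c := ka) L0) => //.
by move=> x s; have /andP[] := kbnd x s.
Qed.

Lemma coef_norm x s : `|k x s| <= kb.
Proof.
have /andP[k1 k2] := kbnd x s.
by rewrite ger0_norm// (le_trans (ltW ka0)).
Qed.

Lemma element_sub i : (i < n)%N -> el i `<=` Omega a b.
Proof.
move=> iN x; rewrite /Omega/= !in_itv/= => /andP[h1 h2].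
rewrite (le_lt_trans (subdivision_ge st (ltnW iN)))//=.
by rewrite (lt_le_trans h2)// (subdivision_le_b st).
Qed.

(** As v' is constant on element i, the flux integral there is [slope t v i] times this number. *)
Definition coef_int v i : R := \int[leb R]_(x in el i) k x (v x).

Lemma measurable_element i : measurable (el i).
Proof. exact: measurable_leb_itv. Qed.

Lemma integrable_coef v i : V0 a b n t v -> (i < n)%N ->
  (leb R).-integrable (el i) (EFin \o (fun x => k x (v x))).
Proof.
move=> Vv iN; apply: (@integrable_leb_bounded _ _ _ kb).
  by apply: measurable_funS (measurable_coef Vv);
    [exact: measurable_leb_itv|exact: element_sub].
by move=> x _; exact: coef_norm.
Qed.

(** On each of the two elements of the support, v' and the derivative of the hat function are
    constants, so only the coefficient stays under the integral. *)
Lemma pairing_hat kappa v i : V0 a b n t v -> (i.+1 < n)%N ->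
  {ae leb R, forall x, Omega a b x -> forall s, kappa x s = k x s} ->
  pairing a b (fun x => kappa x (v x) * derive1 v x) (derive1 (hat t i)) =
  slope t v i * coef_int v i / (t i.+1 - t i) -
  slope t v i.+1 * coef_int v i.+1 / (t i.+2 - t i.+1).
Proof.
move=> Vv iN hk; have iN' := ltnW iN.
pose c j := slope t v j / (t j.+1 - t j).
pose M (x : lebR R) : R := k x (v x).
(* Extension by zero turns the two element integrals into integrals over the whole interval. *)
pose g j := (fun x => c j * M x) \_ (el j).
have mg j : (j < n)%N -> measurable_fun (Omega a b) (g j).
  move=> jN; apply/measurable_restrict; [exact: measurable_element|exact: measurable_leb_itv|].
  rewrite setIidr; last exact: element_sub.
  apply: measurable_funM; first exact: measurable_cst.
  by apply: measurable_funS (measurable_coef Vv);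
    [exact: measurable_leb_itv|exact: element_sub].
have ig j : (j < n)%N -> (leb R).-integrable (Omega a b) (EFin \o g j).
  move=> jN; apply: (@integrable_leb_bounded _ _ _ (`|c j| * kb)); first exact: mg.
  move=> x _; rewrite /g patchE; case: ifPn => _.
    by rewrite normrM ler_wpM2l// coef_norm.
  by rewrite normr0 mulr_ge0// (le_trans (normr_ge0 _) (coef_norm 0 0)).
have intg j : (j < n)%N ->
    \int[leb R]_(x in Omega a b) g j x = slope t v j * coef_int v j / (t j.+1 - t j).
  move=> jN; rewrite /g -Rintegral_mkcondr setIidr; last exact: element_sub.
  rewrite RintegralZl; [|exact: measurable_element|exact: integrable_coef].
  by rewrite /c /coef_int mulrAC.
rewrite -!intg// -RintegralB; [|exact: measurable_leb_itv|exact: ig|exact: ig].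
apply: ae_eq_Rintegral_leb; first exact: measurable_leb_itv.
  by apply: measurable_funB; exact: mg.
(* The integrands are compared only off the nodes, which form a null set. *)
have hn : {ae leb R, forall x : lebR R,
    [/\ (x : R) != t i, (x : R) != t i.+1 & (x : R) != t i.+2]}.
  have h0 := ae_neq_leb (t i); have h1 := ae_neq_leb (t i.+1).
  have h2 := ae_neq_leb (t i.+2); apply: filterS3 h0 h1 h2 => x; by split.
apply: filterS2 hk hn => x kx [x0 x1 x2] xO.
rewrite (derive1_hat st iN)// kx// /g !patchE !mem_setE/=.
have [xi|xi] := boolP (x \in `]t i, t i.+1[).
  have -> : x \in `]t i.+1, t i.+2[ = false.
    move: xi; rewrite !in_itv/= => /andP[_ xi].
    by rewrite ltNge (ltW xi).
  (* Outside its set a restricted function takes the default value [point], which is 0 for the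
     reals. *)
  by rewrite (V0_derive1 st Vv iN' xi) /c /M -[point]/(0 : R)
    -[true%:R]/(1 : R) -[false%:R]/(0 : R); ring.
have [xj|xj] := boolP (x \in `]t i.+1, t i.+2[).
  by rewrite (V0_derive1 st Vv iN xj) /c /M -[point]/(0 : R)
    -[true%:R]/(1 : R) -[false%:R]/(0 : R); ring.
by rewrite -[point]/(0 : R) !mul0r !subrr mulr0.
Qed.

Lemma measure_element i : (i < n)%N -> fine (leb R (el i)) = t i.+1 - t i.
Proof. by move=> iN; rewrite leb_itvoo// ltW// (subdivision_lt st). Qed.

Lemma integrable_element_continuous (M : R) (g : R -> R) i : continuous g ->
  (forall x, x \in `]t i, t i.+1[ -> `|g x| <= M) ->
  (leb R).-integrable (el i) (EFin \o g).
Proof.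
move=> cg gM; apply: (@integrable_leb_bounded _ _ _ M) => //.
apply: measurable_fun_leb; first exact: measurable_itv.
by apply: measurable_funTS; exact: continuous_measurable_fun.
Qed.

Lemma coef_int_ge v i : V0 a b n t v -> (i < n)%N ->
  ka * (t i.+1 - t i) <= coef_int v i.
Proof.
move=> Vv iN; rewrite -(measure_element iN) -Rintegral_cst; last exact: measurable_element.
apply: le_Rintegral; first exact: measurable_element.
- apply: (@integrable_element_continuous `|ka|) => //; exact: cst_continuous.
- exact: integrable_coef.
- by move=> x _; have /andP[] := kbnd x (v x).
Qed.

Lemma integral_element_affine (A B : R) i : (i < n)%N ->
  \int[leb R]_(x in el i) (A + B * (x - t i)) =
  A * (t i.+1 - t i) + B * ((t i.+1 - t i) ^+ 2 / 2).
Proof.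
move=> iN; have lt := subdivision_lt st iN.
have cB : continuous (fun x : R => x - t i).
  by move=> x; apply: cvgB; [exact: cvg_id|exact: cvg_cst].
have xh x : x \in `]t i, t i.+1[ -> `|x - t i| <= t i.+1 - t i.
  rewrite in_itv/= => /andP[h1 h2]; rewrite ger0_norm; last by rewrite subr_ge0 ltW.
  by rewrite lerD2r ltW.
rewrite RintegralD; [|exact: measurable_element| |].
- rewrite Rintegral_cst; last exact: measurable_element.
  rewrite measure_element// RintegralZl; [|exact: measurable_element|].
    by rewrite integral_leb_id.
  exact: integrable_element_continuous xh.
- apply: (@integrable_element_continuous `|A|) => //; exact: cst_continuous.
- apply: (@integrable_element_continuous (`|B| * (t i.+1 - t i))) => [x|x xi].
    by apply: cvgM; [exact: cvg_cst|exact: cB].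
  by rewrite normrM ler_wpM2l// xh.
Qed.

(** At relative position s in the element, |v - w| is at most (1 - s) E0 + s E1, where E0 and E1 are
    its values at the nodes; this affine bound has mean (E0 + E1) / 2. *)
Lemma coef_int_lipschitz v w i : V0 a b n t v -> V0 a b n t w -> (i < n)%N ->
  `|coef_int v i - coef_int w i| <=
  L * ((t i.+1 - t i) *
       ((`|v (t i) - w (t i)| + `|v (t i.+1) - w (t i.+1)|) / 2)).
Proof.
move=> Vv Vw iN; have lt := subdivision_lt st iN.
set E0 := `|v (t i) - w (t i)|; set E1 := `|v (t i.+1) - w (t i.+1)|.
set h := t i.+1 - t i; have h0 : 0 < h by rewrite subr_gt0.
have iv := integrable_coef Vv iN; have iw := integrable_coef Vw iN.
rewrite /coef_int -RintegralB; [|exact: measurable_element|exact: iv|exact: iw].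
have mk' : measurable_fun (el i) ((fun x => k x (v x) - k x (w x)) : lebR R -> R).
  by apply: measurable_funB; apply/measurable_EFinP;
    [exact: (measurable_int _ iv)|exact: (measurable_int _ iw)].
have bk x : `|k x (v x) - k x (w x)| <= kb + kb.
  by rewrite (le_trans (ler_normB _ _))// lerD// coef_norm.
apply: le_trans.
  apply: le_normr_Rintegral; first exact: measurable_element.
  exact: (integrable_leb_bounded mk').
(* The right-hand side is the integral of L (E0 + (E1 - E0) (x - t_i) / h), so a pointwise
   comparison suffices. *)
rewrite (_ : L * _ = L * E0 * h + L * ((E1 - E0) / h) * (h ^+ 2 / 2)); last first.
  by field; rewrite gt_eqF.
rewrite -integral_element_affine//.
apply: le_Rintegral; first exact: measurable_element.
- apply: (@integrable_leb_bounded _ _ _ (kb + kb)).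
    exact: measurableT_comp.
  by move=> x _; rewrite normr_id.
- apply: (@integrable_element_continuous (L * E0 + L * `|E1 - E0|)) => x.
    apply: cvgD; first exact: cvg_cst.
    by apply: cvgM; [exact: cvg_cst|apply: cvgB; [exact: cvg_id|exact: cvg_cst]].
  rewrite in_itv/= => /andP[x0 x1].
  rewrite (le_trans (ler_normD _ _))// lerD//.
    by rewrite ger0_norm ?mulr_ge0 ?(ltW L0) ?normr_ge0.
  rewrite !normrM (gtr0_norm L0) -!mulrA ler_wpM2l ?(ltW L0)// ler_piMr//.
  rewrite normfV (gtr0_norm h0) ger0_norm; last by rewrite subr_ge0 ltW.
  by rewrite mulrC ler_pdivrMr// mul1r lerD2r ltW.
- move=> x /= /subset_itv_oo_cc xi.
  apply: (le_trans (klip _ _ _)); rewrite -!mulrA -mulrDr ler_wpM2l ?(ltW L0)//.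
  rewrite (V0_affine st Vv iN xi) (V0_affine st Vw iN xi).
  pose s := (x - t i) / h.
  have s01 : 0 <= s <= 1.
    move: xi; rewrite in_itv/= => /andP[x0 x1].
    rewrite divr_ge0 ?subr_ge0 ?(ltW lt)//=.
    by rewrite ler_pdivrMr// mul1r lerD2r.
  rewrite (_ : _ - _ = (1 - s) * (v (t i) - w (t i)) +
      s * (v (t i.+1) - w (t i.+1))); last first.
    by rewrite /slope /s /h; field; rewrite subr_eq0 gt_eqF.
  have /andP[s0 s1] := s01.
  rewrite (le_trans (ler_normD _ _))// [`|(1 - s) * _|]normrM [`|s * _|]normrM.
  rewrite (ger0_norm s0) (@ger0_norm _ (1 - s)) ?subr_ge0// le_eqVlt.
  by apply/orP; left; apply/eqP; rewrite -/E0 -/E1 /s; field; rewrite gt_eqF.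
Qed.

(** The flux difference splits as (D / h) Mw + slope(u) (Mu - Mw). Times D, the first term is at
    least ka D^2, and the second at least -D^2 |u(t_i) - u(t_(i+1))| L / 2. The equation with |D|
    says that u - w has opposite signs, or vanishes, at the two ends; it lets |D| replace the nodal
    values in the Lipschitz estimate. *)
Lemma element_flux_zero u w i : V0 a b n t u -> V0 a b n t w -> (i < n)%N ->
  `|u (t i) - u (t i.+1)| < 2 * ka / L ->
  let D := (u (t i.+1) - w (t i.+1)) - (u (t i) - w (t i)) in
  `|u (t i) - w (t i)| + `|u (t i.+1) - w (t i.+1)| = `|D| ->
  (slope t u i * coef_int u i - slope t w i * coef_int w i) * D <= 0 ->
  D = 0.
Proof.
move=> Vu Vw iN du D eD; have lt := subdivision_lt st iN.
have := coef_int_lipschitz Vu Vw iN; have := coef_int_ge Vw iN.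
rewrite eD; set Mu := coef_int u i; set Mw := coef_int w i.
set h := t i.+1 - t i; have h0 : 0 < h by rewrite subr_gt0.
move=> Mge Mlip JD.
(* The smallness assumption on the increment of u, multiplied by L / 2. *)
have P0 : 0 < ka - `|u (t i.+1) - u (t i)| * L / 2.
  move: du; rewrite distrC ltr_pdivlMr// => du.
  move: (_ * L) du => X; lra.
have JE : (slope t u i * Mu - slope t w i * Mw) * D =
    D ^+ 2 / h * Mw + (u (t i.+1) - u (t i)) / h * (Mu - Mw) * D.
  by rewrite /slope -/h /D; field; rewrite gt_eqF.
have T1 : D ^+ 2 * ka <= D ^+ 2 / h * Mw.
  rewrite -mulrA ler_wpM2l ?sqr_ge0// mulrC ler_pdivlMr//.
have T2 : - (D ^+ 2 * (`|u (t i.+1) - u (t i)| * L / 2)) <=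
    (u (t i.+1) - u (t i)) / h * (Mu - Mw) * D.
  rewrite lerNl (le_trans (ler_norm _))// normrN !normrM normfV (gtr0_norm h0).
  rewrite -[D ^+ 2]real_normK ?num_real//.
  have -> : `|D| ^+ 2 * (`|u (t i.+1) - u (t i)| * L / 2) =
     `|u (t i.+1) - u (t i)| / h * (L * (h * (`|D| / 2))) * `|D|.
    by field; rewrite gt_eqF.
  by rewrite ler_wpM2r// ler_wpM2l// divr_ge0// ltW.
have : D ^+ 2 * (ka - `|u (t i.+1) - u (t i)| * L / 2) <= 0.
  apply: le_trans JD; rewrite JE mulrBr.
  exact: lerD.
rewrite pmulr_lle0// => D2; apply/eqP; rewrite -sqrf_eq0.
by rewrite eq_le D2 sqr_ge0.
Qed.

End Coefficient.

(** * A discrete sign argument at the nodes *)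

Lemma nonincreasing_crossing_zero (e : nat -> R) n : e 0%N = 0 -> e n = 0 ->
  (forall i, (i < n)%N -> 0 <= e i -> e i.+1 <= 0 -> e i.+1 - e i = 0) ->
  forall i, (i <= n)%N -> e i = 0.
Proof.
move=> e0 en H.
(* Forward: a first negative value would follow a nonnegative one and, by the zero increment, equal
   it. *)
have pos i : (i <= n)%N -> 0 <= e i.
  elim: i => [|i IH] iN; first by rewrite e0.
  rewrite leNgt; apply/negP => ei.
  have /eqP := H i iN (IH (ltnW iN)) (ltW ei).
  rewrite subr_eq0 => /eqP h; move: (IH (ltnW iN)); rewrite -h leNgt ei //.
(* Backward from e_n = 0: a positive value would equal its nonpositive successor. *)
have neg j : (j <= n)%N -> e (n - j)%N <= 0.
  elim: j => [|j IH] jN; first by rewrite subn0 en.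
  rewrite leNgt; apply/negP => ej.
  have jn : (n - j.+1 < n)%N by lia.
  have S : (n - j.+1).+1 = (n - j)%N by lia.
  have := IH (ltnW jN); rewrite -S => ej1.
  have /eqP := H _ jn (ltW ej) ej1; rewrite subr_eq0 => /eqP h.
  by move: ej; rewrite -h ltNge ej1.
move=> i iN; apply/le_anti; rewrite pos// andbT.
by have := neg (n - i)%N (leq_subr _ _); rewrite subKn.
Qed.

End HatFunctions.

(** * Comparison of two discrete solutions *)

Theorem corollary2p2 (R : realType) (a b : R) (hab : a < b)
    (n : nat) (t : nat -> R) (ht : subdivision a b n t)
    (kappa : R -> R -> R) (hkappa : caratheodory_function a b kappa)
    (ka kb : R) (hka : 0 < ka) (hkab : ka < kb)
    (hbound : forall s : R,
       \forall x \ae leb R, Omega a b x -> ka < kappa x s < kb)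
    (L0 : R) (hL0 : 0 < L0)
    (hlip : forall s r : R, \forall x \ae leb R,
       Omega a b x -> `|kappa x s - kappa x r| <= L0 * `|s - r|)
    (f : (R -> R) -> R) (hf : Hminus1 a b f)
    (u : R -> R) (hu : discrete_solution a b kappa f n t u)
    (hmax : \big[Num.max/0]_(k < n) `|u (t k) - u (t k.+1)| < 2 * ka / L0) :
  forall w : R -> R, discrete_solution a b kappa f n t w ->
    forall x, x \in `[a, b] -> w x = u x.
Proof.
move=> w [Vw sw]; have [Vu su] := hu.
have [k [mk kbnd klip kE]] := regular_coefficient hkappa hkab hL0 hbound hlip.
have [t0 tn _] := ht; have [_ _ ua ub] := Vu; have [_ _ wa wb] := Vw.
pose h i := t i.+1 - t i.
have h0 i : (i < n)%N -> 0 < h i by move=> iN; rewrite subr_gt0 (subdivision_lt ht).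
pose J i := slope t u i * coef_int t k u i - slope t w i * coef_int t k w i.
(* Testing both equations with the hat function at t_(i+1) cancels f and equates the means on
   adjacent elements. *)
have Jh i : (i.+1 < n)%N -> J i / h i = J i.+1 / h i.+1.
  move=> iN; have Vh := V0_hat ht iN.
  have := su _ Vh; rewrite -(sw _ Vh).
  rewrite !(pairing_hat ht hka hL0 mk kbnd klip _ iN kE)//.
  by rewrite /J !mulrBl => /eqP E; apply/eqP; lra.
have JC i : (i < n)%N -> J i = J 0%N / h 0%N * h i.
  move=> iN; suff -> : J 0%N / h 0%N = J i / h i by rewrite divfK// gt_eqF// h0.
  elim: i iN => [//|i IH] iN; exact: etrans (IH (ltnW iN)) (Jh i iN).
pose e i := u (t i) - w (t i).
have e0 : e 0%N = 0 by rewrite /e t0 ua wa subrr.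
have en : e n = 0 by rewrite /e tn ub wb subrr.
have du i : (i < n)%N -> `|u (t i) - u (t i.+1)| < 2 * ka / L0.
  move=> iN; have /bigmax_ltP[_ H] := hmax.
  exact: (H (Ordinal iN)).
have elt i : (i < n)%N -> `|e i| + `|e i.+1| = `|e i.+1 - e i| ->
    J i * (e i.+1 - e i) <= 0 -> e i.+1 - e i = 0.
  by move=> iN; exact: (element_flux_zero ht hka hL0 mk kbnd klip Vu Vw iN (du i iN)).
clearbody J.
have ez i : (i <= n)%N -> e i = 0.
  (* A nonnegative common ratio makes all J_i >= 0; where e passes from >= 0 to <= 0 its increment D
     is <= 0, so J_i D <= 0 and [elt] gives D = 0. *)
  have [C0|C0] := leP 0 (J 0%N / h 0%N).
    apply: nonincreasing_crossing_zero e0 en _ i => i iN ei ei1.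
    have De : e i.+1 - e i <= 0 by rewrite subr_le0 (le_trans ei1).
    apply: elt => //.
      by rewrite (ger0_norm ei) (ler0_norm ei1) (ler0_norm De) [RHS]opprB.
    apply: mulr_ge0_le0 De; rewrite (JC i iN); apply: mulr_ge0 C0 _; exact: ltW (h0 i iN).
  move=> iN; apply/eqP; rewrite -oppr_eq0; apply/eqP.
  (* For a negative ratio, downward crossings of -e are upward crossings of e, where D >= 0 and J_i
     <= 0. *)
  apply: (@nonincreasing_crossing_zero R (fun i => - e i) n) => //.
  - by rewrite e0 oppr0.
  - by rewrite en oppr0.
  move=> {}i {}iN; rewrite oppr_ge0 oppr_le0 => ei ei1.
  have De : 0 <= e i.+1 - e i by rewrite subr_ge0 (le_trans ei).
  rewrite -opprD; apply/eqP; rewrite oppr_eq0; apply/eqP; apply: elt => //.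
    by rewrite (ler0_norm ei) (ger0_norm ei1) (ger0_norm De) addrC.
  apply: mulr_le0_ge0 De; rewrite (JC i iN).
  by apply: mulr_le0_ge0; [exact: ltW C0|exact: ltW (h0 i iN)].
(* Agreement at the nodes spreads to each closed element, where both functions are affine. *)
move=> x /(subdivision_cover ht)[->|[i iN xi]]; first by rewrite ua wa.
have eqn j : (j <= n)%N -> w (t j) = u (t j).
  by move=> jN; apply/esym/eqP; rewrite -subr_eq0; apply/eqP; exact: ez.
rewrite (V0_affine ht Vu iN xi) (V0_affine ht Vw iN xi) /slope.
by rewrite !eqn// ltnW.
Qed.
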